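(* Let $k,n\in\mathbb{N}$. The equality $$\operatorname{wrdet}_k(A)=\frac1{k^{kn}}\sum_{\sigma\in S_k^n}\det\nolimits_{T_0}(\sigma\cdot A)$$ holds for any $A\in\mathrm{Mat}_{kn,n}$.
   Context: $\mathrm{Mat}_{m,n}$ is the set of $m\times n$ matrices with entries in a commutative $\mathbb{C}$-algebra. $\mathfrak{S}_N$ is the symmetric group of degree $N$ and $\nu_N(w)$ is the number of cycles of $w\in\mathfrak{S}_N$ (fixed points included). For an $N\times N$ matrix $B=(b_{ij})$, $\det_k B:=\sum_{w\in\mathfrak{S}_N}(-\tfrac1k)^{N-\nu_N(w)}b_{w(1)1}\cdots b_{w(N)N}$. For a matrix $A$ with $n$ columns, $A^{[k]}$ is obtained by repeating each column of $A$ $k$ times consecutively, and for $A\in\mathrm{Mat}_{kn,n}$, $\operatorname{wrdet}_k A:=\det_k(A^{[k]})$. For a standard tableau $T=(t_{ij})_{1\le i\le n,1\le j\le k}$ of rectangular shape $(k^n)$ ($n$ rows of length $k$), $\det_T(A):=\prod_{l=1}^k\det(a_{t_{il},j})_{1\le i,j\le n}$; $T_0$ is the standard tableau whose $(i,j)$-entry is $(i-1)k+j$. $S_k^n\subset\mathfrak{S}_{kn}$ is the subgroup ($\cong\mathfrak{S}_k^n$) of permutations preserving each block $\{(i-1)k+1,\dots,ik\}$, $1\le i\le n$. For $\sigma\in\mathfrak{S}_{kn}$, $\sigma\cdot A=(a_{\sigma^{-1}(i)j})_{i,j}$. *)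

(* Defs.v *)
From HB Require Import structures.
From mathcomp Require Import all_boot all_order all_algebra all_fingroup.
From mathcomp Require Import reals.
From mathcomp Require Import complex.

Set Implicit Arguments.
Unset Strict Implicit.
Unset Printing Implicit Defensive.

Import GRing.Theory.
Local Open Scope ring_scope.

(* Indices are shifted to start at 0: the i-th block {(i-1)k+1, ..., ik}      *)
(* becomes {ik, ..., ik+k-1} for i < n, and the (i,j) entry (i-1)k+j of T_0   *)
(* becomes ik+j for i < n and j < k.                                          *)

Section BlockIndices.
Variables k n : nat.

Lemma block_of_subproof (x : 'I_(k * n)) : (x %/ k < n)%N.
Proof.
have lt_x : (val x < k * n)%N := ltn_ord x.
have k_gt0 : (0 < k)%N by move: (leq_ltn_trans (leq0n _) lt_x); rewrite muln_gt0 => /andP[].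
by rewrite ltn_divLR // [leqRHS]mulnC.
Qed.

Definition block_of (x : 'I_(k * n)) : 'I_n := Ordinal (block_of_subproof x).

Lemma block_entry_subproof (i : 'I_n) (j : 'I_k) : (i * k + j < k * n)%N.
Proof.
apply: (@leq_trans (i.+1 * k)); first by rewrite mulSn addnC ltn_add2r.
by rewrite mulnC leq_mul2l ltn_ord orbT.
Qed.

Definition block_entry (i : 'I_n) (j : 'I_k) : 'I_(k * n) :=
  Ordinal (block_entry_subproof i j).

Definition block (i : 'I_n) : {set 'I_(k * n)} :=
  [set x : 'I_(k * n) | (i * k <= x < i.+1 * k)%N].

(* 'N(S | 'P) is the setwise stabiliser of S. *)
Definition Sblock : {group 'S_(k * n)} :=
  (\bigcap_(i < n) 'N(block i | 'P))%G.

Definition is_std_tableau (T : 'M['I_(k * n)]_(n, k)) : bool :=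
  [&& [forall x, #|[set p : 'I_n * 'I_k | T p.1 p.2 == x]| == 1%N],
      [forall i : 'I_n, forall j : 'I_k, forall j' : 'I_k,
         (j < j')%N ==> (T i j < T i j')%N]
    & [forall i : 'I_n, forall i' : 'I_n, forall j : 'I_k,
         (i < i')%N ==> (T i j < T i' j)%N]].

Definition std_tableau := {T : 'M['I_(k * n)]_(n, k) | is_std_tableau T}.

Lemma T0_subproof : is_std_tableau (\matrix_(i, j) block_entry i j).
Proof.
apply/and3P; split.
- apply/forallP => x; have lt_x : (val x < k * n)%N := ltn_ord x.
  have k_gt0 : (0 < k)%N by move: (leq_ltn_trans (leq0n _) lt_x); rewrite muln_gt0 => /andP[].
  apply/cards1P; exists (block_of x, Ordinal (ltn_pmod x k_gt0)).
  apply/setP => -[i j]; rewrite !inE mxE /=.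
  apply/eqP/eqP => [<-|[-> ->]]; last by apply: val_inj; rewrite /= -divn_eq.
  congr pair; apply: val_inj => /=; last by rewrite modnMDl modn_small.
  by rewrite divnMDl // divn_small // addn0.
- apply/forallP => i; apply/forallP => j; apply/forallP => j'.
  by apply/implyP => lt_jj'; rewrite !mxE /= ltn_add2l.
- apply/forallP => i; apply/forallP => i'; apply/forallP => j.
  apply/implyP => lt_ii'; rewrite !mxE /= ltn_add2r ltn_mul2r lt_ii' andbT.
  exact: leq_ltn_trans (ltn_ord j).
Qed.

Definition T0 : std_tableau :=
  exist (fun T => is_true (is_std_tableau T)) _ T0_subproof.

End BlockIndices.

Section WreathDeterminant.
Variables (C : fieldType) (R : comAlgType C).

(* porbits w is the set of cycles of w, fixed points included. *)
Definition det_k (k N : nat) (B : 'M[R]_N) : R :=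
  \sum_(w : 'S_N)
    (- (k%:R : C)^-1) ^+ (N - #|porbits w|) *: \prod_(i < N) B (w i) i.

Definition rep_col (k m n : nat) (A : 'M[R]_(m, n)) : 'M[R]_(m, k * n) :=
  \matrix_(i < m, j < k * n) A i (block_of j).

Definition wrdet (k n : nat) (A : 'M[R]_(k * n, n)) : R :=
  det_k k (rep_col k A).

Definition det_tab (k n : nat) (T : std_tableau k n)
    (A : 'M[R]_(k * n, n)) : R :=
  \prod_(l < k) \det (\matrix_(i < n, j < n) A (sval T i l) j).

Definition perm_act (m n : nat) (s : 'S_m) (A : 'M[R]_(m, n)) :
    'M[R]_(m, n) :=
  row_perm s^-1%g A.

End WreathDeterminant.

Arguments wrdet {C R} k {n} A.

(* Main.v *)
Require Import Defs.
From HB Require Import structures.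
From mathcomp Require Import all_boot all_order all_algebra all_fingroup.
From mathcomp Require Import reals.
From mathcomp Require Import complex.

(** The idea is to read powers of k as numbers of colourings.  For a
    permutation w of N points with nu cycles,
      (-1/k)^(N - nu) = sgn(w) k^nu / k^N,
    and k^nu counts the colourings f of the N points by k colours that are
    constant on the cycles of w, i.e. such that f o w = f
    ([card_invariant_colourings]).  Exchanging the sums over w and f turns
    det_k into a sum of ordinary determinants ([det_k_colourings]):
      det_k B = k^(-N) sum_f det (B with entry (x, y) killed if f x <> f y).
    Both sides compute the coefficient of x_1 ... x_N in det(1 + XB/k)^k, where
    X = diag(x_1, ..., x_N): this is MacMahon's expansion of
    det(1 - alpha XB)^(-1/alpha) at alpha = -1/k, whose exponent k is a natural
    number.

    Let now B be A with each column repeated k times.  If f gives the same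
    colour to two points of one block, the corresponding columns of the
    killed matrix coincide and its determinant vanishes.  Otherwise f is a
    bijection from each block onto the k colours, which amounts to saying that
    f x is the position, inside its block, of s x for a unique s that
    preserves the blocks.  For such an f the killed matrix is, up to the same
    reordering of its rows and columns, block diagonal with one n x n block
    per colour l, made of the rows s^-1(T_0(i, l)) of A; its determinant is
    therefore det_{T_0}(s . A) ([det_block_diag], [det_tab_T0]). *)

Set Implicit Arguments.
Unset Strict Implicit.
Unset Printing Implicit Defensive.

Import GRing.Theory.
Local Open Scope ring_scope.

Section Coordinates.
Variables k n : nat.
Implicit Types (x y : 'I_(k * n)) (i : 'I_n) (j : 'I_k).

Lemma offset_of_subproof x : (x %% k < k)%N.
Proof.
by rewrite ltn_mod; case: k x => [|//] -[x]; rewrite mul0n.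
Qed.

(** The column of T_0 that contains x, just as [block_of x] is its row. *)
Definition offset_of x : 'I_k := Ordinal (offset_of_subproof x).

Lemma block_entryK i j : block_of (block_entry i j) = i.
Proof.
apply: val_inj => /=.
by rewrite divnMDl ?divn_small ?addn0 //; apply: leq_ltn_trans (ltn_ord j).
Qed.

Lemma offset_entryK i j : offset_of (block_entry i j) = j.
Proof. by apply: val_inj; rewrite /= modnMDl modn_small. Qed.

Lemma block_entry_eta x : block_entry (block_of x) (offset_of x) = x.
Proof. by apply: val_inj; rewrite /= -divn_eq. Qed.

Lemma mem_block i x : (x \in block k i) = (block_of x == i).
Proof.
rewrite inE -[x]block_entry_eta block_entryK.
move: (block_of x) (offset_of x) => b j; rewrite /=.
have k0 : (0 < k)%N by apply: leq_ltn_trans (ltn_ord j).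
rewrite -leq_divRL // -ltn_divLR // divnMDl // divn_small // addn0 ltnS.
by rewrite -eqn_leq eq_sym.
Qed.

(** A permutation stabilising every block setwise fixes the index of the block
    of each point; this pointwise form is the one used with colourings. *)
Lemma SblockP (s : 'S_(k * n)) :
  reflect (forall x, block_of (s x) = block_of x) (s \in Sblock k n).
Proof.
apply: (iffP bigcapP) => [Ss x | Ss i _].
  by apply/eqP; have := astabs_act x (Ss (block_of x) isT);
    rewrite !mem_block eqxx.
by apply/astabsP => x; have := Ss x; rewrite !mem_block => <-.
Qed.

End Coordinates.

(** A colouring invariant under w is constant on cycles, hence is the same
    thing as a map from the set of cycles to the colours. *)
Lemma card_invariant_colourings (N k : nat) (w : 'S_N) :
  #|[set f : {ffun 'I_N -> 'I_k} | [forall x, f (w x) == f x]]|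
    = (k ^ #|porbits w|)%N.
Proof.
have mem_porbits x : porbit w x \in porbits w by apply: imset_f.
pose lift_col (g : {ffun {O | O \in porbits w} -> 'I_k}) :=
  [ffun x => g (Sub (porbit w x) (mem_porbits x))] : {ffun 'I_N -> 'I_k}.
have lift_inj : injective lift_col.
  move=> g h /ffunP gh; apply/ffunP => -[O Ow]; have /imsetP[x _ Ox] := Ow.
  have := gh x; rewrite !ffunE.
  by congr (g _ = h _); apply: val_inj; rewrite /= -Ox.
(* The image of [lift_col] is exactly the set of invariant colourings. *)
rewrite -[RHS](_ : #|{ffun {O | O \in porbits w} -> 'I_k}| = _); last first.
  by rewrite card_ffun card_ord card_sig; congr (_ ^ _)%N; apply: eq_card.
rewrite -(card_codom lift_inj); apply: eq_card => f; rewrite inE.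
apply/forallP/codomP => [fw | [g ->] x]; last first.
  rewrite !ffunE; apply/eqP; congr (g _); apply: val_inj => /=.
  exact: porbit_perm w 1 x.
have f_orb x y : porbit w x = porbit w y -> f x = f y.
  move=> /eqP; rewrite eq_porbit_mem => /porbitP[m ->].
  by elim: m => [|m IH]; rewrite ?expg0 ?perm1 // expgSr permM (eqP (fw _)).
have ex (O : {O | O \in porbits w}) : exists x, porbit w x == val O.
  by case: O => O /= /imsetP[x _ ->]; exists x.
exists [ffun O => f (xchoose (ex O))]; apply/ffunP => x; rewrite !ffunE.
by apply: f_orb; rewrite (eqP (xchooseP (ex _))).
Qed.

Lemma sign_cycles (N : nat) (w : 'S_N) : odd (N - #|porbits w|) = w.
Proof.
rewrite oddB; first by rewrite /odd_perm card_ord.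
by rewrite -[leqRHS](card_ord N); apply: leq_imset_card.
Qed.

(** A cycle of length m has signature (-1)^(m - 1), so (-1)^(N - nu) is the
    signature of w; the remaining factor k^(nu - N) is the number of colourings
    invariant under w, normalised by the number k^N of all colourings. *)
Lemma cycle_weight (C : fieldType) (k N : nat) (w : 'S_N) :
  k%:R != 0 :> C ->
  (- (k%:R : C)^-1) ^+ (N - #|porbits w|) =
    (-1) ^+ w * (k ^ #|porbits w|)%:R / k%:R ^+ N.
Proof.
move=> k0; rewrite [LHS]exprNn -[in LHS]signr_odd sign_cycles -mulrA.
congr (_ * _).
have le_wN : (#|porbits w| <= N)%N.
  by rewrite -[leqRHS](card_ord N); apply: leq_imset_card.
by rewrite exprB ?unitfE ?invr_eq0 // !exprVn invrK natrX mulrC.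
Qed.

(** In the Leibniz expansion of the f-th determinant, w survives exactly when
    f o w = f, so that w is counted k^nu times in total. *)
Lemma det_k_colourings (C : fieldType) (R : comAlgType C) (k N : nat)
    (B : 'M[R]_N) : k%:R != 0 :> C ->
  det_k k B = (k%:R ^+ N : C)^-1 *:
    \sum_(f : {ffun 'I_N -> 'I_k})
      \det (\matrix_(x, y) if f x == f y then B x y else 0).
Proof.
(* [det_k] lets w act on row indices, \det on column indices. *)
move=> k0; under [in RHS]eq_bigr => f _ do rewrite -det_tr.
rewrite exchange_big scaler_sumr; apply: eq_bigr => w _.
rewrite -mulr_sumr cycle_weight // [_ * _ / _]mulrC -scalerA; congr (_ *: _).
rewrite -scalerA scaler_sign mulr_sign.
suff -> : \sum_(f : {ffun 'I_N -> 'I_k}) \prod_i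
     (\matrix_(x, y) (if f x == f y then B x y else 0))^T i (w i)
   = (k ^ #|porbits w|)%:R *: \prod_i B (w i) i by [].
rewrite scaler_nat -card_invariant_colourings -sumr_const [RHS]big_mkcond /=.
apply: eq_bigr => f _; rewrite inE; case: forallP => [fw | /forallP].
  by apply: eq_bigr => i _; rewrite !mxE (eqP (fw i)) eqxx.
rewrite negb_forall => /existsP[i fwi].
by rewrite (bigD1 i) //= !mxE (negPf fwi) mul0r.
Qed.

Section BlockDeterminant.
Variable R : comPzRingType.

Lemma det_conj_inj (N : nat) (g : 'I_N -> 'I_N) (M : 'M[R]_N) :
  injective g -> \det (\matrix_(x, y) M (g x) (g y)) = \det M.
Proof.
move=> g_inj; pose p := perm g_inj.
have -> : \matrix_(x, y) M (g x) (g y) = row_perm p (col_perm p M).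
  by apply/matrixP => x y; rewrite !mxE !permE.
rewrite row_permE col_permE !det_mulmx !det_perm odd_permV mulrCA.
by rewrite -signr_addb addbb mulr1.
Qed.

(** The column reading order of an n x k array: unlike the row order of
    [block_entry], it makes the points of one colour consecutive. *)
Let colmajor (k n : nat) (l : 'I_k) (i : 'I_n) : 'I_(k * n) :=
  cast_ord (mulnC n k) (block_entry l i).

(** In this order M is honestly block diagonal, and as k.+1 * n computes to
    n + k * n the first block can be split off by induction on k. *)
Let det_colmajor (n k : nat) (F : 'I_k -> 'M[R]_n) (M : 'M[R]_(k * n)) :
  (forall l i l' i', M (colmajor l i) (colmajor l' i') =
     if l == l' then F l i i' else 0) ->
  \det M = \prod_l \det (F l).
Proof.
elim: k F M => [F M _ | k IH F M MF]; first by rewrite big_ord0 det_mx00.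
have lshiftE (i : 'I_n) : lshift (k * n) i = colmajor (@ord0 k) i.
  by apply: val_inj; rewrite /= add0n.
have rshiftE (l : 'I_k) (i : 'I_n) :
    rshift n (colmajor l i) = colmajor (lift ord0 l) i.
  by apply: val_inj; rewrite /= mulSn addnA.
have colmajor_onto (y : 'I_(k * n)) : exists l i, y = colmajor l i.
  pose x := cast_ord (mulnC k n) y.
  exists (block_of x), (offset_of x); apply: val_inj.
  by rewrite /= -[LHS](congr1 val (block_entry_eta x)).
rewrite big_ord_recl -(IH (fun l => F (lift ord0 l))
  (drsubmx (M : 'M_(n + k * n)))); last first.
  by move=> l i l' i'; rewrite !mxE !rshiftE MF (inj_eq lift_inj).
rewrite -[M in LHS](submxK (M : 'M_(n + k * n))).
have -> : ulsubmx (M : 'M_(n + k * n)) = F ord0.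
  by apply/matrixP => i j; rewrite !mxE !lshiftE MF eqxx.
have -> : dlsubmx (M : 'M_(n + k * n)) = 0.
  apply/matrixP => y j; rewrite !mxE lshiftE.
  by have [l [i ->]] := colmajor_onto y; rewrite rshiftE MF.
by rewrite det_ublock.
Qed.

(** Any enumeration e of the index set may be traded for the column reading
    order by permuting rows and columns simultaneously, which leaves the
    determinant unchanged. *)
Lemma det_block_diag (k n : nat) (e : 'I_k -> 'I_n -> 'I_(k * n))
    (F : 'I_k -> 'M[R]_n) (M : 'M[R]_(k * n)) :
  (forall l i l' i', e l i = e l' i' -> (l, i) = (l', i')) ->
  (forall l i l' i', M (e l i) (e l' i') = if l == l' then F l i i' else 0) ->
  \det M = \prod_l \det (F l).
Proof.
move=> e_inj MF.
(* [g] carries the column reading order to the enumeration [e]. *)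
pose dec (x : 'I_(k * n)) := let y := cast_ord (mulnC k n) x in
  (block_of y, offset_of y).
pose g x := e (dec x).1 (dec x).2.
have g_inj : injective g.
  move=> x y /e_inj [bxy oxy]; apply: (@cast_ord_inj _ _ (mulnC k n)).
  rewrite -[LHS]block_entry_eta -[RHS]block_entry_eta.
  by congr block_entry; apply: val_inj; rewrite /= ?bxy ?oxy.
rewrite -(det_conj_inj M g_inj); apply: det_colmajor => l i l' i'.
rewrite mxE /g /dec /colmajor.
have cK p : cast_ord (mulnC k n) (cast_ord (mulnC n k) p) = p by apply: val_inj.
by rewrite !cK !block_entryK !offset_entryK.
Qed.
End BlockDeterminant.

(** The points coloured l by x |-> offset_of (s x) are the s^-1(T_0(i, l)), with
    i the index of their block: the matrix on the left is block diagonal along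
    this enumeration, with the matrices in the definition of det_tab as its
    blocks. *)
Lemma det_tab_T0 (C : fieldType) (R : comAlgType C) (k n : nat)
    (s : 'S_(k * n)) (A : 'M[R]_(k * n, n)) : s \in Sblock k n ->
  \det (\matrix_(x, y) if offset_of (s x) == offset_of (s y)
                       then A x (block_of y) else 0) =
  det_tab (T0 k n) (perm_act s A).
Proof.
move=> /SblockP Ss.
apply: (@det_block_diag _ _ _ (fun l i => s^-1%g (block_entry i l))).
  move=> l i l' i' /perm_inj eq_li.
  have := congr1 (@offset_of k n) eq_li; rewrite !offset_entryK => ->.
  by have := congr1 (@block_of k n) eq_li; rewrite !block_entryK => ->.
move=> l i l' i'; rewrite !mxE !permKV !offset_entryK -[block_of _]Ss.
by rewrite permKV block_entryK.
Qed.

(** The sum over colourings is restricted to those of the form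
    x |-> offset_of (s x) with s in [Sblock k n]; all the others give the same
    colour to two points of a block, that is, to two equal columns. *)
Lemma wrdet_sum_det_tab (C : fieldType) (R : comAlgType C)
    (k n : nat) (hk : k%:R != 0 :> C) (A : 'M[R]_(k * n, n)) :
  wrdet k A =
    ((k%:R : C) ^+ (k * n))^-1 *:
      \sum_(s in Sblock k n) det_tab (T0 k n) (perm_act s A).
Proof.
rewrite /wrdet det_k_colourings //; congr (_ *: _).
pose col (s : 'S_(k * n)) := [ffun x => offset_of (s x)].
have col_inj : {in Sblock k n &, injective col}.
  move=> s t /SblockP Ss /SblockP St /ffunP st; apply/permP => x.
  have := st x; rewrite !ffunE => stx.
  by rewrite -[LHS]block_entry_eta -[RHS]block_entry_eta stx Ss St.
transitivity (\sum_(f in [set col s | s in Sblock k n])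
    \det (\matrix_(x, y) if f x == f y then rep_col k A x y else 0)); last first.
  rewrite big_imset //=; apply: eq_bigr => s Ss; rewrite -det_tab_T0 //.
  by congr (\det _); apply/matrixP => x y; rewrite !mxE !ffunE.
rewrite [RHS]big_mkcond; apply: eq_bigr => f _; case: ifPn => // f_col.
(* If f comes from a block-preserving permutation, that permutation can only
   be [place]; so the two cases are whether [place] is injective. *)
pose place x := block_entry (block_of x) (f x).
have [/injectiveP place_inj | /injectivePn[x [y neq_xy eq_xy]]] :=
    boolP (injectiveb place).
  case/negP: f_col; apply/imsetP; exists (perm place_inj).
    by apply/SblockP => x; rewrite permE block_entryK.
  by apply/ffunP => x; rewrite ffunE permE offset_entryK.
rewrite -det_tr; apply: (determinant_alternate neq_xy) => z; rewrite !mxE.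
have := congr1 (@offset_of k n) eq_xy; rewrite !offset_entryK => ->.
by have := congr1 (@block_of k n) eq_xy; rewrite !block_entryK => ->.
Qed.

Local Open Scope complex_scope.

Theorem corollary5p7 (RR : realType) (R : comAlgType RR[i])
    (k n : nat) (hk : (0 < k)%N) (A : 'M[R]_(k * n, n)) :
  wrdet k A =
    ((k%:R : RR[i]) ^+ (k * n))^-1 *:
      \sum_(s in Sblock k n) det_tab (T0 k n) (perm_act s A).
Proof.
apply: wrdet_sum_det_tab.
by rewrite Num.Theory.pnatr_eq0 -lt0n.
Qed.
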